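(* Let $n\geq 1$ be an integer and let $G=\prod_{i=1}^n G_i$ be a direct product of finite groups $G_1,\ldots,G_n$ such that every maximal subgroup $M$ of $G$ splits as a direct product $M=\prod_{i=1}^n M_i$ with $M_i\leq G_i$ for every $i$. If each of $G_1,\ldots,G_n$ satisfies the $(\mu,\lambda)$-property, then $G$ satisfies the $(\mu,\lambda)$-property.
   Context: For a finite poset $\mathcal{P}$, the Möbius function $\mu_{\mathcal{P}}:\mathcal{P}\times\mathcal{P}\to\mathbb{Z}$ is defined by $\mu_{\mathcal{P}}(x,y)=0$ if $x\not\leq y$, $\mu_{\mathcal{P}}(x,x)=1$, and $\mu_{\mathcal{P}}(x,y)=-\sum_{x<z\leq y}\mu_{\mathcal{P}}(z,y)$ if $x<y$. For a finite group $G$, let $\mathcal{L}$ be the lattice of all subgroups of $G$ ordered by inclusion, and let $\mathcal{C}$ be the poset of conjugacy classes $[H]$ of subgroups $H\leq G$, ordered by $[H]\leq[K]$ if and only if $H\leq K^g$ for some $g\in G$. For $H\leq G$ put $\mu(H)=\mu_{\mathcal{L}}(H,G)$ and $\lambda(H)=\mu_{\mathcal{C}}([H],[G])$. $G'$ is the derived (commutator) subgroup of $G$, and $N_{G'}(H)=\{g\in G' : H^g=H\}$. The group $G$ satisfies the $(\mu,\lambda)$-property if $\mu(H)=[N_{G'}(H):G'\cap H]\cdot\lambda(H)$ for every $H\leq G$. *)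

(* Defs.v *)
From HB Require Import structures.
From mathcomp Require Import all_boot all_order all_fingroup all_solvable all_algebra.

Set Implicit Arguments.
Unset Strict Implicit.
Unset Printing Implicit Defensive.

Import Order.TTheory GRing.Theory.
Import GroupScope.

Section Mobius.

Variables (d : Order.disp_t) (P : finPOrderType d).
Implicit Types x y z : P.

(* The recursion on x is not structural, so it runs on a fuel k. Chains in P
   have at most #|P| elements, so the fuel #|P| is never exhausted: [mobius_lt]
   below is the defining recursion. *)
Fixpoint mobius_fuel (k : nat) x y : int :=
  if x == y then 1%R
  else if (x < y)%O then
    if k is k'.+1 then
      (- \sum_(z | (x < z <= y)%O) mobius_fuel k' z y)%R
    else 0%R
  else 0%R.

Definition mobius x y : int := mobius_fuel #|P| x y.

Lemma mobius_fuel_stable k1 k2 x y :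
    #|[pred z | (x < z <= y)%O]| <= k1 -> #|[pred z | (x < z <= y)%O]| <= k2 ->
  mobius_fuel k1 x y = mobius_fuel k2 x y.
Proof.
elim: k1 k2 x y => [|k1 IH] [|k2] x y //=.
- rewrite leqn0 => /eqP/card0_eq S0 _.
  case: eqP => // _; case: ifP => // xy.
  by have := S0 y; rewrite !inE xy lexx.
- move=> _; rewrite leqn0 => /eqP/card0_eq S0.
  case: eqP => // _; case: ifP => // xy.
  by have := S0 y; rewrite !inE xy lexx.
move=> le1 le2; case: eqP => // _; case: ifP => // xy; congr (- _)%R.
apply: eq_bigr => z /andP[xz zy].
have: #|[pred t | (z < t <= y)%O]| < #|[pred t | (x < t <= y)%O]|.
  apply/proper_card/properP; split.
    by apply/subsetP=> t; rewrite !inE => /andP[zt ->]; rewrite (lt_trans xz zt).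
  by exists z; rewrite !inE ?xz ?zy // ltxx.
by move=> lt; apply: IH; rewrite -ltnS (leq_trans lt).
Qed.

Lemma mobius_nle x y : ~~ (x <= y)%O -> mobius x y = 0%R.
Proof.
rewrite /mobius; case: #|P| => [|k] /= nxy;
  (case: eqP => [exy|_]; first by rewrite exy lexx in nxy);
  by case: ifP => // /ltW xy; rewrite xy in nxy.
Qed.

Lemma mobius_refl x : mobius x x = 1%R.
Proof. by rewrite /mobius; case: #|P| => [|k] /=; rewrite eqxx. Qed.

Lemma mobius_lt x y :
  (x < y)%O -> mobius x y = (- \sum_(z | (x < z <= y)%O) mobius z y)%R.
Proof.
move=> xy.
have -> : mobius x y = mobius_fuel #|P|.+1 x y.
  by apply: mobius_fuel_stable; [exact: max_card | exact/leqW/max_card].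
by rewrite /= (lt_eqF xy) xy.
Qed.

End Mobius.

Fact subgroup_display : Order.disp_t. Proof. exact: Order.Disp tt tt. Qed.
Fact subgroup_class_display : Order.disp_t.
Proof. exact: Order.Disp tt tt. Qed.

Section SubgroupPosets.

Variables (gT : finGroupType) (G : {group gT}).
Implicit Types H K : {group gT}.

Record subgroup_of : predArgType := SubgroupOf {
  subgroup_val :> {group gT};
  _ : subgroup_val \subset G }.

HB.instance Definition _ := [isSub for subgroup_val].
HB.instance Definition _ := [Finite of subgroup_of by <:].

Definition subgroup_le (H K : subgroup_of) : bool := H \subset K.

Lemma subgroup_le_refl : reflexive subgroup_le.
Proof. by move=> H; exact: subxx. Qed.

Lemma subgroup_le_anti : antisymmetric subgroup_le.
Proof.
by move=> H K HK; apply/val_inj/val_inj/eqP; rewrite /= eqEsubset.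
Qed.

Lemma subgroup_le_trans : transitive subgroup_le.
Proof. by move=> K H L; exact: subset_trans. Qed.

HB.instance Definition _ := Order.Le_isPOrder.Build subgroup_display
  subgroup_of subgroup_le_refl subgroup_le_anti subgroup_le_trans.

Lemma leEsubgroup (H K : subgroup_of) : (H <= K)%O = (H \subset K).
Proof. by []. Qed.

Definition whole_subgroup : subgroup_of := SubgroupOf (subxx G).

Record subgroup_class_of : predArgType := SubgroupClassOf {
  subgroup_class_val :> {set {group gT}};
  _ : subgroup_class_val \in orbit 'JG%act G @: subgroups G }.

HB.instance Definition _ := [isSub for subgroup_class_val].
HB.instance Definition _ := [Finite of subgroup_class_of by <:].

Lemma subgroup_class_subproof (H : subgroup_of) :
  orbit 'JG%act G H \in orbit 'JG%act G @: subgroups G.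
Proof. by apply: imset_f; rewrite inE (valP H). Qed.

Definition subgroup_class (H : subgroup_of) : subgroup_class_of :=
  SubgroupClassOf (subgroup_class_subproof H).

(* Stated on representatives; [subgroup_class_leE] shows that it does not
   depend on their choice. *)
Definition subgroup_class_le (C D : subgroup_class_of) : bool :=
  [exists H in C, exists K in D, exists g in G, H \subset K :^ g].

Lemma subgroup_classP (C : subgroup_class_of) :
  exists H : subgroup_of, C = subgroup_class H.
Proof.
case: C => C /[dup] /imsetP[H]; rewrite inE => sHG ->{C} pC.
by exists (SubgroupOf sHG); apply: val_inj.
Qed.

Lemma subgroup_class_leE (H K : subgroup_of) :
  subgroup_class_le (subgroup_class H) (subgroup_class K) =
  [exists g in G, H \subset K :^ g].
Proof.
apply/idP/idP.
  case/exists_inP=> _ /orbitP[a Ga <-] /exists_inP[_ /orbitP[b Gb <-]].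
  case/exists_inP=> g Gg /=; rewrite -conjsgM sub_conjg -conjsgM => sHK.
  by apply/exists_inP; exists (b * g * a^-1); rewrite ?groupM ?groupV.
case/exists_inP=> g Gg sHK.
apply/exists_inP; exists (H : {group gT}); first exact: orbit_refl.
apply/exists_inP; exists (K : {group gT}); first exact: orbit_refl.
by apply/exists_inP; exists g.
Qed.

Lemma subgroup_class_le_refl : reflexive subgroup_class_le.
Proof.
move=> C; have [H ->] := subgroup_classP C; rewrite subgroup_class_leE.
by apply/exists_inP; exists 1; rewrite ?group1 // conjsg1.
Qed.

Lemma subgroup_class_le_anti : antisymmetric subgroup_class_le.
Proof.
move=> C D; have [H ->] := subgroup_classP C; have [K ->] := subgroup_classP D.
rewrite !subgroup_class_leE => /andP[/exists_inP[g Gg sHK]].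
case/exists_inP=> h Gh /subset_leq_card; rewrite cardJg => leKH.
apply/val_inj/orbit_eqP/orbitP; exists g => //=.
by apply/val_inj/eqP; rewrite /= eq_sym eqEcard sHK cardJg.
Qed.

Lemma subgroup_class_le_trans : transitive subgroup_class_le.
Proof.
move=> D C E; have [H ->] := subgroup_classP C.
have [K ->] := subgroup_classP D; have [L ->] := subgroup_classP E.
rewrite !subgroup_class_leE => /exists_inP[g Gg sHK] /exists_inP[h Gh sKL].
apply/exists_inP; exists (h * g); first exact: groupM.
by rewrite (subset_trans sHK) // conjsgM conjSg.
Qed.

HB.instance Definition _ := Order.Le_isPOrder.Build subgroup_class_display
  subgroup_class_of subgroup_class_le_refl subgroup_class_le_anti
  subgroup_class_le_trans.

Lemma leEsubgroup_class (H K : subgroup_of) :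
  (subgroup_class H <= subgroup_class K)%O = [exists g in G, H \subset K :^ g].
Proof. exact: subgroup_class_leE. Qed.

Lemma subgroup_class_eqP (H K : subgroup_of) :
  reflect (exists2 g, g \in G & H = K :^ g :> {set gT})
          (subgroup_class H == subgroup_class K).
Proof.
apply: (iffP eqP) => [/(congr1 val)/orbit_eqP/orbitP[g Gg <-]|[g Gg eHK]].
  by exists g.
apply/val_inj/orbit_eqP/orbitP; exists g => //; exact/val_inj.
Qed.

Definition subgroup_mu (H : subgroup_of) : int := mobius H whole_subgroup.

Definition subgroup_lambda (H : subgroup_of) : int :=
  mobius (subgroup_class H) (subgroup_class whole_subgroup).

Definition mu_lambda_property : Prop :=
  forall H : subgroup_of,
    subgroup_mu H =
    (#|'N_(G^`(1))(H) : G^`(1) :&: H|%g%:Z * subgroup_lambda H)%R.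

End SubgroupPosets.

(* Main.v *)
Require Import Defs.
From mathcomp Require Import all_boot all_order all_fingroup all_solvable all_algebra.

(** Write G for the product of the groups G_i. A subgroup H of G lies in a
    smallest subgroup of product form, the product of its projections, so
    projections and products form a Galois insertion between the subgroups of G
    and the families of subgroups of the G_i. Conjugation in G acts
    coordinatewise, so the same holds for conjugacy classes. The hypothesis on
    maximal subgroups enters once: if all projections of H are full then H = G,
    since otherwise H lies in a maximal subgroup of product form, which is then
    all of G ([subgroup_proj_whole]).

    For any Galois insertion of a product of posets into a poset P in which only
    the top of P projects to the top, the Moebius function to the top of P
    vanishes outside the image and is the product of the Moebius functions of
    the factors on it ([mobius_closed], [mobius_nclosed]). The function so
    described has the right sums over up-sets, because an element of the image
    is above x exactly when it is coordinatewise above the projections of x, and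
    these sums determine the Moebius function ([mobius_uniq]).

    Hence mu and lambda both vanish at subgroups that are not of product form,
    and both are multiplicative at the others. There the index of
    [G' :&: H] in [N_G'(H)] is multiplicative too ([index_norm_der_setXn]), and
    the identity for G is the product of the identities for the G_i. *)

Set Implicit Arguments.
Unset Strict Implicit.
Unset Printing Implicit Defensive.

Import Order.TTheory GRing.Theory.
Import GroupScope.

(** * Moebius functions and Galois insertions of products *)

Section MobiusProduct.

Lemma mobius_sum d (P : finPOrderType d) (x t : P) : (x <= t)%O ->
  (\sum_(z | (x <= z <= t)%O) mobius z t = (x == t)%:R)%R.
Proof.
move=> xt; have [->|nxt] := eqVneq x t.
  rewrite (big_pred1 t) ?mobius_refl // => z.
  by rewrite /= -eq_le eq_sym.
rewrite (bigD1 x) ?lexx ?xt //= mobius_lt ?lt_neqAle ?nxt //.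
rewrite addrC; apply/eqP; rewrite subr_eq0; apply/eqP/eq_bigl => z.
by rewrite [in RHS]lt_neqAle eq_sym andbC andbA.
Qed.

(** The identities of [mobius_sum] form a unitriangular system, solved from the
    top down: the induction is on the number of elements above x. *)
Lemma mobius_uniq d (P : finPOrderType d) (t : P) (f : P -> int) :
    (forall x, (x <= t)%O ->
      \sum_(z | (x <= z <= t)%O) f z = (x == t)%:R)%R ->
  forall x, (x <= t)%O -> mobius x t = f x.
Proof.
move=> fS x; have [k] := ubnP #|[pred z | (x <= z)%O]|.
elim: k x => // k IH x lexk xt.
have := fS x xt; rewrite -(mobius_sum xt).
rewrite !(bigD1 (P := fun z => (x <= z <= t)%O) x) ?lexx ?xt //=.
rewrite (eq_bigr (fun z => mobius z t)) => [/addIr //|z].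
case/andP=> /andP[xz zt] nzx; apply/esym/IH => //.
rewrite -ltnS; apply: leq_trans lexk; rewrite ltnS; apply/proper_card/properP; split.
  by apply/subsetP => y; rewrite !inE; apply: le_trans.
by exists x; rewrite !inE ?lexx // lt_geF // lt_neqAle eq_sym nzx.
Qed.

(** Distributivity with a summation type that depends on the index. *)
Lemma prod_sum_fprod (R : comPzSemiRingType) (I : finType) (T : I -> finType)
    (Q : forall i, pred (T i)) (F : forall i, T i -> R) :
  (\prod_i \sum_(j | Q i j) F i j =
   \sum_(f : fprod T | [forall i, Q i (f i)]) \prod_i F i (f i))%R.
Proof.
(* Extending F by 0 reduces this to sums without a condition. *)
pose F' i := [ffun j : T i => (if Q i j then F i j else 0)%R].
transitivity (\sum_(f : fprod T) \prod_i F' i (f i))%R.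
  rewrite big_fprod -(bigA_distr_big_dep _ (fun i => untag 0%R (F' i))).
  apply: eq_bigr => i _.
  rewrite -[RHS](big_tag (fun i => F' i) i) big_mkcond.
  by apply: eq_bigr => j _; rewrite ffunE.
rewrite [RHS]big_mkcond; apply: eq_bigr => f _.
case: forallP => [Qf|/forallP].
  by apply: eq_bigr => i _; rewrite ffunE Qf.
rewrite negb_forall => /existsP[i /negbTE nQ].
by rewrite (bigD1 i) //= ffunE nQ mul0r.
Qed.

(** In the Galois insertion below, [p] projects and [e] embeds the product. The
    elements [e y] are the closed ones, and [e (p x)] is the closure of x. *)
Variables (d d' : Order.disp_t) (P : finPOrderType d) (I : finType).
Variables (Q : I -> finPOrderType d') (t : P) (q : forall i, Q i).
Variables (p : P -> forall i, Q i) (e : fprod Q -> P).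
Hypothesis le_t : forall x, (x <= t)%O.
Hypothesis le_q : forall i (y : Q i), (y <= q i)%O.
Hypothesis adj : forall x (y : fprod Q),
  (x <= e y)%O = [forall i, (p x i <= y i)%O].
Hypothesis eK : forall (y : fprod Q) i, p (e y) i = y i.
Hypothesis p_top : forall x, (forall i, p x i = q i) -> x = t.

Let pt i : p t i = q i.
Proof.
have : (t <= e [fprod i => q i])%O.
  by rewrite adj; apply/forallP => j; rewrite fprodE le_q.
move=> te; have <- : e [fprod i => q i] = t by apply/le_anti; rewrite le_t te.
by rewrite eK fprodE.
Qed.

Let f x : int :=
  (if x == e [fprod i => p x i] then \prod_i mobius (p x i) (q i) else 0)%R.

(** Summing [f] over the elements above x leaves the closed ones, that is the
    families above [p x]; the sum then factors into the sums of [mobius_sum] for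
    the posets [Q i], so it is 1 if [p x] is the top family and 0 otherwise. *)
Let mobius_f x : mobius x t = f x.
Proof.
apply: mobius_uniq => // {}x _.
under eq_bigl do rewrite le_t andbT.
rewrite /f -big_mkcondr /=.
rewrite (reindex_onto e (fun z => [fprod i => p z i])) /=; last first.
  by move=> z /andP[_ /eqP].
transitivity (\sum_(y : fprod Q | [forall i, (p x i <= y i)%O])
   \prod_i mobius (y i) (q i))%R.
  apply: eq_big => [y|y _]; last by apply: eq_bigr => i _; rewrite eK.
  have -> : [fprod i => p (e y) i] = y by apply/fprodP => i; rewrite fprodE eK.
  by rewrite !eqxx !andbT adj.
rewrite -(prod_sum_fprod (fun i z => p x i <= z)%O (fun i z => mobius z (q i))).
transitivity (\prod_i ((p x i == q i)%:R : int))%R.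
  apply: eq_bigr => i _; rewrite -mobius_sum //.
  by apply: eq_bigl => z; rewrite le_q andbT.
have [->|nxt] := eqVneq x t; first by rewrite big1 // => i _; rewrite pt eqxx.
have [i npq] : exists i, p x i != q i.
  apply/existsP; rewrite -negb_forall; apply: contra nxt => /forallP pxq.
  by apply/eqP/p_top => i; apply/eqP.
by rewrite (bigD1 i) //= (negbTE npq) mul0r.
Qed.

Lemma mobius_closed y : mobius (e y) t = (\prod_i mobius (y i) (q i))%R.
Proof.
rewrite mobius_f /f.
have -> : [fprod i => p (e y) i] = y by apply/fprodP => i; rewrite fprodE eK.
by rewrite eqxx; apply: eq_bigr => i _; rewrite eK.
Qed.

Lemma mobius_nclosed x : (forall y, x != e y) -> mobius x t = 0%R.
Proof. by move=> nx; rewrite mobius_f /f (negbTE (nx _)). Qed.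

End MobiusProduct.

(** * Direct products of groups *)

Section SetXn.

Variables (I : finType) (gT : I -> finGroupType).
Implicit Types (A B : forall i, {set gT i}) (H K : forall i, {group gT i}).
Local Notation gTn := {dffun forall i, gT i}.

Lemma setXnI A B : setXn A :&: setXn B = setXn (fun i => A i :&: B i).
Proof.
apply/setP => x; rewrite in_setI; apply/andP/setXnP.
  by case=> /setXnP xA /setXnP xB i; rewrite in_setI xA xB.
by move=> xAB; split; apply/setXnP => i; have /setIP[] := xAB i.
Qed.

Lemma setXnJ A (g : gTn) : setXn A :^ g = setXn (fun i => A i :^ g i).
Proof.
apply/setP => x; rewrite mem_conjg; apply/setXnP/setXnP => xA i.
  by have := xA i; rewrite mem_conjg /conjg !ffunE.
by have := xA i; rewrite mem_conjg /conjg !ffunE.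
Qed.

(** The adjunction between projections and products, for subgroups. *)
Lemma sub_setXn (H : {group gTn}) A :
  (H \subset setXn A) = [forall i, dffun_morphism gT i @* H \subset A i].
Proof.
apply/idP/forallP => [sHA i|sHA].
  apply/subsetP => _ /morphimP[x _ Hx ->].
  by have /setXnP := subsetP sHA x Hx.
apply/subsetP => x Hx; apply/setXnP => i; apply: (subsetP (sHA i)).
by apply: (mem_morphim (dffun_morphism gT i)); rewrite ?inE.
Qed.

Lemma sub_setXn2 H K :
  (setXn H \subset setXn K) = [forall i, H i \subset K i].
Proof.
rewrite (sub_setXn (setXn_group H)); apply: eq_forallb => i.
by rewrite morphim_dffunXn.
Qed.

(** Projections map the derived group onto the derived groups of the factors;
    conversely the product is generated by the embedded factors, whose derived
    groups lie in that of the product. *)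
Lemma der1_setXn H : (setXn H)^`(1) = setXn (fun i => (H i)^`(1)).
Proof.
apply/eqP; rewrite eqEsubset; apply/andP; split.
  rewrite sub_setXn; apply/forallP => i.
  by rewrite morphim_der ?subsetT //= morphim_dffunXn.
rewrite -(setXn_prod (fun i => (H i)^`(1)%G)) prod_subG // => i _ /=.
rewrite -morphim_dfung1 morphim_der ?subsetT // dergS //.
rewrite /= morphim_dfung1 set1gXnE.
by apply: setXnS => j; case: dfwithP => // k _; apply: sub1G.
Qed.

Lemma norm_setXn H : 'N(setXn H) = setXn (fun i => 'N(H i)).
Proof.
apply/setP => g; rewrite inE setXnJ.
have -> : (setXn (fun i => H i :^ g i) \subset setXn H) =
          [forall i, H i :^ g i \subset H i].
  exact: (sub_setXn2 (fun i => H i :^ g i)%G).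
by apply/forallP/setXnP => gN i; have := gN i; rewrite inE.
Qed.

Lemma indexg_setXn H K : (forall i, K i \subset H i) ->
  #|setXn H : setXn K| = (\prod_i #|H i : K i|)%N.
Proof.
move=> sKH; have sX : setXn K \subset setXn H by apply: setXnS.
have := Lagrange (G := setXn_group H) (H := setXn_group K) sX.
rewrite /= !cardsXn -(eq_bigr _ (fun i _ => Lagrange (sKH i))).
by rewrite big_split /= => /eqP; rewrite eqn_pmul2l ?prodn_gt0 // => /eqP->.
Qed.

Lemma index_norm_der_setXn H K :
  #|'N_((setXn H)^`(1))(setXn K) : (setXn H)^`(1) :&: setXn K| =
  (\prod_i #|'N_((H i)^`(1))(K i) : (H i)^`(1) :&: K i|)%N.
Proof.
rewrite der1_setXn norm_setXn !setXnI.
apply: (indexg_setXn (H := fun i => 'N_((H i)^`(1))(K i)%G)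
                     (K := fun i => ((H i)^`(1) :&: K i)%G)) => i.
by rewrite setIS ?normG.
Qed.

End SetXn.

(** * Subgroups and conjugacy classes of subgroups *)

Section ClassRepresentative.

Variables (gT : finGroupType) (G : {group gT}).

Let class_ex (C : subgroup_class_of G) :
  exists H : subgroup_of G, C == subgroup_class H.
Proof. by have [H /eqP] := subgroup_classP C; exists H. Qed.

Definition class_repr (C : subgroup_class_of G) : subgroup_of G :=
  xchoose (class_ex C).

Lemma class_reprK C : subgroup_class (class_repr C) = C.
Proof. by have /eqP := xchooseP (class_ex C). Qed.

Lemma whole_subgroup_max (H : subgroup_of G) : (H <= whole_subgroup G)%O.
Proof. exact: (valP H). Qed.

Lemma whole_class_max (C : subgroup_class_of G) :
  (C <= subgroup_class (whole_subgroup G))%O.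
Proof.
rewrite -[C]class_reprK leEsubgroup_class; apply/exists_inP.
by exists 1; rewrite ?group1 // conjsg1 (valP (class_repr C)).
Qed.

Lemma class_whole (H : subgroup_of G) :
  subgroup_class H = subgroup_class (whole_subgroup G) -> H = whole_subgroup G.
Proof.
move/eqP/subgroup_class_eqP => [g Gg]; rewrite /= conjGid // => eH.
exact/val_inj/val_inj.
Qed.

End ClassRepresentative.

(** * Subgroups of a direct product *)

Section SubgroupsOfProduct.

Variables (I : finType) (gT : I -> finGroupType) (G : forall i, {group gT i}).
Local Notation GX := (setXn_group G).

Lemma proj_subproof (H : subgroup_of GX) i :
  dffun_morphism gT i @* H \subset G i.
Proof. by rewrite -(morphim_dffunXn i G) morphimS // (valP H). Qed.

Definition subgroup_proj (H : subgroup_of GX) i : subgroup_of (G i) :=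
  SubgroupOf (subgroup_val := dffun_morphism gT i @* H)%G (proj_subproof H i).

Lemma subgroup_prod_subproof (K : forall i, subgroup_of (G i)) :
  setXn_group (fun i => K i : {group gT i}) \subset GX.
Proof. by apply: setXnS => i; apply: (valP (K i)). Qed.

Definition subgroup_prod (K : forall i, subgroup_of (G i)) : subgroup_of GX :=
  SubgroupOf (subgroup_prod_subproof K).

Definition class_proj (C : subgroup_class_of GX) i : subgroup_class_of (G i) :=
  subgroup_class (subgroup_proj (class_repr C) i).

Definition class_prod (K : forall i, subgroup_class_of (G i)) :
    subgroup_class_of GX :=
  subgroup_class (subgroup_prod (fun i => class_repr (K i))).

Lemma subgroup_adj H K :
  (H <= subgroup_prod K)%O = [forall i, (subgroup_proj H i <= K i)%O].
Proof. by rewrite leEsubgroup sub_setXn. Qed.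

Lemma subgroup_prodK K i : subgroup_proj (subgroup_prod K) i = K i.
Proof. by apply/val_inj/val_inj; rewrite /= morphim_dffunXn. Qed.

(** The conjugating elements, one for each factor, are the coordinates of a
    single element of the product. *)
Lemma subgroup_class_adj H K :
  (subgroup_class H <= subgroup_class (subgroup_prod K))%O =
  [forall i, (subgroup_class (subgroup_proj H i) <= subgroup_class (K i))%O].
Proof.
rewrite leEsubgroup_class; apply/exists_inP/forallP => [[g Gg sHK] i|sHK].
  rewrite leEsubgroup_class; apply/exists_inP; exists (g i).
    exact: (setXnP Gg).
  by move: sHK; rewrite setXnJ sub_setXn => /forallP/(_ i).
have sHKi i : exists g, (g \in G i) && (subgroup_proj H i \subset K i :^ g).
  have := sHK i; rewrite leEsubgroup_class => /exists_inP[g Gg sg].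
  by exists g; rewrite Gg.
exists [ffun i => xchoose (sHKi i)].
  by apply/setXnP => i; rewrite ffunE; case/andP: (xchooseP (sHKi i)).
rewrite setXnJ sub_setXn; apply/forallP => i; rewrite ffunE.
by case/andP: (xchooseP (sHKi i)).
Qed.

Lemma class_adj C K :
  (C <= class_prod K)%O = [forall i, (class_proj C i <= K i)%O].
Proof.
rewrite -{1}[C]class_reprK subgroup_class_adj.
by apply: eq_forallb => i; rewrite class_reprK.
Qed.

Lemma class_proj_class H i :
  class_proj (subgroup_class H) i = subgroup_class (subgroup_proj H i).
Proof.
have /eqP/subgroup_class_eqP[g Gg eH] := class_reprK (subgroup_class H).
apply/eqP/subgroup_class_eqP; exists (g i); first exact: (setXnP Gg).
by rewrite /= eH morphimJ ?inE.
Qed.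

Lemma class_prodK K i : class_proj (class_prod K) i = K i.
Proof. by rewrite class_proj_class subgroup_prodK class_reprK. Qed.

Lemma class_prod_class K L : (forall i, L i = subgroup_class (K i)) ->
  class_prod L = subgroup_class (subgroup_prod K).
Proof.
move=> eL; apply/le_anti; rewrite class_adj subgroup_class_adj.
apply/andP; split; apply/forallP => i.
  by rewrite subgroup_prodK class_reprK eL.
by rewrite class_proj_class subgroup_prodK eL.
Qed.

Hypothesis hmax : forall M : {group {dffun forall i, gT i}},
  maximal M (setXn G) ->
  exists M_ : forall i, {group gT i},
    (forall i, M_ i \subset G i) /\ M = setXn M_ :> {set _}.

(** A proper subgroup lies in a maximal one, whose factors contain its
    projections. *)
Lemma subgroup_proj_whole H :
  (forall i, subgroup_proj H i = whole_subgroup (G i)) -> H = whole_subgroup GX.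
Proof.
move=> pH; apply/val_inj; have := valP H; rewrite /= => sHG.
have [//|[M maxM sHM]] := maximal_exists sHG.
  by move/val_inj.
have [M_ [sMG eM]] := hmax maxM.
case/maxgroupP: maxM => /andP[_ /negP nGM] _; case: nGM.
rewrite eM; apply: setXnS => i.
move: sHM; rewrite eM sub_setXn => /forallP/(_ i).
by have /(congr1 (fun K : subgroup_of (G i) => K : {set _})) /= -> := pH i.
Qed.

Lemma class_proj_whole C :
    (forall i, class_proj C i = subgroup_class (whole_subgroup (G i))) ->
  C = subgroup_class (whole_subgroup GX).
Proof.
move=> pC; rewrite -[C]class_reprK; congr subgroup_class.
by apply: subgroup_proj_whole => i; apply/class_whole/pC.
Qed.

Lemma subgroup_mu_prod (K : fprod (fun i => subgroup_of (G i))) :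
  subgroup_mu (subgroup_prod K) = (\prod_i subgroup_mu (K i))%R.
Proof.
apply: (mobius_closed (p := subgroup_proj) (e := fun K => subgroup_prod K)).
- exact: whole_subgroup_max.
- by move=> i; apply: whole_subgroup_max.
- by move=> H L; apply: subgroup_adj.
- by move=> L i; apply: subgroup_prodK.
- exact: subgroup_proj_whole.
Qed.

Lemma subgroup_lambda_prod (K : fprod (fun i => subgroup_of (G i))) :
  subgroup_lambda (subgroup_prod K) = (\prod_i subgroup_lambda (K i))%R.
Proof.
rewrite /subgroup_lambda.
rewrite -(class_prod_class (L := [fprod i => subgroup_class (K i)])); last first.
  by move=> i; rewrite fprodE.
rewrite (mobius_closed (p := class_proj) (e := fun L => class_prod L)
  (q := fun i => subgroup_class (whole_subgroup (G i)))).
- by apply: eq_bigr => i _; rewrite fprodE.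
- exact: whole_class_max.
- by move=> i; apply: whole_class_max.
- by move=> C L; apply: class_adj.
- by move=> L i; apply: class_prodK.
- exact: class_proj_whole.
Qed.

Lemma subgroup_mu_nprod (H : subgroup_of GX) :
  H != subgroup_prod (subgroup_proj H) -> subgroup_mu H = 0%R.
Proof.
move=> nH; apply: (mobius_nclosed (p := subgroup_proj)
  (e := fun K : fprod (fun i => subgroup_of (G i)) => subgroup_prod K)
  (q := fun i => whole_subgroup (G i))).
- exact: whole_subgroup_max.
- by move=> i; apply: whole_subgroup_max.
- by move=> K L; apply: subgroup_adj.
- by move=> L i; apply: subgroup_prodK.
- exact: subgroup_proj_whole.
move=> K; apply: contra nH => /eqP ->.
apply/eqP/val_inj/val_inj => /=; apply: eq_setXn => i.
by rewrite morphim_dffunXn.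
Qed.

Lemma subgroup_lambda_nprod (H : subgroup_of GX) :
  H != subgroup_prod (subgroup_proj H) -> subgroup_lambda H = 0%R.
Proof.
move=> nH; apply: (mobius_nclosed (p := class_proj)
  (e := fun L : fprod (fun i => subgroup_class_of (G i)) => class_prod L)
  (q := fun i => subgroup_class (whole_subgroup (G i)))).
- exact: whole_class_max.
- by move=> i; apply: whole_class_max.
- by move=> C L; apply: class_adj.
- by move=> L i; apply: class_prodK.
- exact: class_proj_whole.
(* A subgroup conjugate to a product is a product itself. *)
move=> L; apply: contra nH => /subgroup_class_eqP[g _ eH].
apply/eqP/val_inj/val_inj; rewrite /= eH /= setXnJ; apply: eq_setXn => i.
by rewrite (morphim_dffunXn i (fun i => class_repr (L i) :^ g i)%G).
Qed.

Lemma mu_lambda_setXn :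
  (forall i, mu_lambda_property (G i)) -> mu_lambda_property GX.
Proof.
move=> hG H; have [eH|nH] := eqVneq H (subgroup_prod (subgroup_proj H)).
  have -> : H = subgroup_prod [fprod i => subgroup_proj H i].
    rewrite [LHS]eH; apply/val_inj/val_inj => /=; apply: eq_setXn => i.
    by rewrite fprodE.
  set K := [fprod i => _].
  rewrite subgroup_mu_prod subgroup_lambda_prod.
  rewrite (index_norm_der_setXn G (fun i => K i : {group _})).
  rewrite (big_morph Posz PoszM erefl) -big_split /=.
  by apply: eq_bigr => i _; apply: hG.
by rewrite subgroup_mu_nprod ?subgroup_lambda_nprod ?mulr0.
Qed.

End SubgroupsOfProduct.

Theorem proposition4p2 (n : nat) (hn : 1 <= n)
    (gT : 'I_n -> finGroupType) (G : forall i : 'I_n, {group gT i})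
    (hmax : forall M : {group {dffun forall i : 'I_n, gT i}},
        maximal M (setXn G) ->
        exists M_ : forall i : 'I_n, {group gT i},
          (forall i : 'I_n, M_ i \subset G i) /\
          M = setXn M_ :> {set _})
    (hG : forall i : 'I_n, mu_lambda_property (G i)) :
  mu_lambda_property (setXn_group G).
Proof. exact: mu_lambda_setXn hmax hG. Qed.
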